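(* Let $\lambda,c>0$ and $a<b$ be real numbers. Let $\{X(t)\}_{t\ge 0}$ be the telegraph process with velocity $c$ and switching rate $\lambda$, let $D(t)\in\{d_0,d_1\}$ be its direction at time $t$ ($d_0$ = right, $d_1$ = left), and let $\tau=\inf\{t>0:\ X(t)\notin[a,b]\}$. For $x\in[a,b]$ and $j=0,1$ put $$h_j(x)=\mathbb{E}\big[\tau\,\big|\,X(0)=x,\ D(0)=d_j\big],\qquad h(x)=\mathbb{E}\big[\tau\,\big|\,X(0)=x\big]=\frac{h_0(x)+h_1(x)}{2}.$$ Then for every $x\in[a,b]$, $$h_0(x)=\frac{\lambda}{c^2}(b-x)(x-a)+\frac{b-x}{c},\qquad h_1(x)=\frac{\lambda}{c^2}(b-x)(x-a)+\frac{x-a}{c},$$ and consequently $$h(x)=\frac{\lambda}{c^2}(b-x)(x-a)+\frac{b-a}{2c}.$$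
   Context: Telegraph process: a particle starts at $X(0)=x\in\mathbb{R}$ and at time $0$ starts moving rightwards (direction $d_0$) or leftwards (direction $d_1$), each with probability $\frac12$. It moves along the real line with constant speed $c>0$ and reverses its direction at each event of a homogeneous Poisson process $N(t)$ with intensity $\lambda>0$, independent of the initial direction. $D(t)$ denotes the direction at time $t$. In particular, if the process starts at $b$ with direction $d_0$, or at $a$ with direction $d_1$, then $\tau=0$. *)

(* Defs.v *)
From HB Require Import structures.
From mathcomp Require Import all_boot all_order all_algebra.
From mathcomp Require Import all_classical all_reals all_analysis.

Set Implicit Arguments.
Unset Strict Implicit.
Unset Printing Implicit Defensive.

Import Order.TTheory GRing.Theory Num.Theory.
Import numFieldNormedType.Exports.

Local Open Scope classical_set_scope.
Local Open Scope ring_scope.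

(* The product rule for a subfamily is the case [B i = setT] off it. *)
Definition mutually_independent (d d' : measure_display) (T : measurableType d)
    (U : measurableType d') (R : realType) (P : probability T R)
    (n : nat) (Y : 'I_n -> T -> U) : Prop :=
  forall B : 'I_n -> set U, (forall i, measurable (B i)) ->
    P (\bigcap_(i in [set: 'I_n]) (Y i @^-1` B i)) =
    (\prod_(i < n) P (Y i @^-1` B i))%E.

Definition independent_systems (d : measure_display) (T : measurableType d)
    (R : realType) (P : probability T R) (F G : set (set T)) : Prop :=
  forall A B, F A -> G B -> P (A `&` B) = (P A * P B)%E.

Definition process_sigma (d : measure_display) (T : Type)
    (U : measurableType d) (R : realType) (Y : R -> T -> U) : set (set T) :=
  <<s \bigcup_(t in [set t : R | 0 <= t])
        preimage_set_system [set: T] (Y t) measurable >>.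

(* Increments are truncated differences in [nat]; this is harmless because the
   paths are nondecreasing.  Only the times [t >= 0] are constrained. *)
Record poisson_process (d : measure_display) (T : measurableType d)
    (R : realType) (P : probability T R) (lambda : R) (N : R -> T -> nat) :
    Prop := PoissonProcess {
  pp_measurable : forall t : R, 0 <= t -> measurable_fun [set: T] (N t) ;
  pp_start : forall w, N 0 w = 0%N ;
  pp_nondecreasing : forall w (s t : R), 0 <= s -> s <= t -> (N s w <= N t w)%N ;
  pp_right_continuous : forall w (t : R), 0 <= t ->
    \forall s \near t^'+, N s w = N t w ;
  pp_increment_law : forall s t : R, 0 <= s -> s < t -> forall k : nat,
    P [set w | (N t w - N s w)%N = k] = (poisson_pmf (lambda * (t - s)) k)%:E ;
  pp_increment_indep : forall (n : nat) (t : nat -> R), 0 <= t 0%N ->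
    (forall i, (i < n)%N -> t i < t i.+1) ->
    mutually_independent P
      (fun (i : 'I_n) (w : T) => (N (t i.+1) w - N (t i) w)%N)
}.

Notation direction := bool.
Definition d0 : direction := true.  (* rightwards *)
Definition d1 : direction := false. (* leftwards *)

Definition velocity (R : realType) (c : R) (e : direction) : R :=
  if e then c else - c.

(* Almost surely all jumps of [N] have size 1, so that reversing the direction
   [N t] times is reversing it once at each event up to time [t]. *)
Record telegraph_process (d : measure_display) (T : measurableType d)
    (R : realType) (P : probability T R) (lambda c x : R)
    (N : R -> T -> nat) (D : R -> T -> direction) (X : R -> T -> R) :
    Prop := TelegraphProcess {
  tp_poisson : poisson_process P lambda N ;
  tp_dir0_measurable : measurable_fun [set: T] (D 0) ;
  tp_dir0_law : forall e : direction, P [set w | D 0 w = e] = (2^-1)%:E ;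
  tp_dir0_indep : independent_systems P
    (preimage_set_system [set: T] (D 0) measurable) (process_sigma N) ;
  tp_dir : forall (t : R) w, 0 <= t -> D t w = iter (N t w) negb (D 0 w) ;
  tp_pos : forall (t : R) w, 0 <= t ->
    X t w = x + \int[@lebesgue_measure R]_(s in `[0, t]) velocity c (D s w)
}.

(* [+oo] if the process never leaves [[a, b]]. *)
Definition exit_time (T : Type) (R : realType) (a b : R) (X : R -> T -> R)
    (w : T) : \bar R :=
  ereal_inf [set t%:E | t in [set t : R | 0 < t /\ ~ (a <= X t w <= b)]].

(* Elementary conditional expectation given an event of positive probability. *)
Definition cond_expectation (d : measure_display) (T : measurableType d)
    (R : realType) (P : probability T R) (Y : T -> \bar R) (A : set T) :
    \bar R :=
  ((fine (P A))^-1%:E * \int[P]_(w in A) Y w)%E.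

(* Main.v *)
Require Import Defs.
From HB Require Import structures.
From mathcomp Require Import all_boot all_order all_algebra.
From mathcomp Require Import all_classical all_reals all_analysis.
From mathcomp Require Import measurable_realfun ring lra.

Set Implicit Arguments.
Unset Strict Implicit.
Unset Printing Implicit Defensive.

Import Order.TTheory GRing.Theory Num.Theory.
Import numFieldNormedType.Exports.

Local Open Scope classical_set_scope.
Local Open Scope ring_scope.

(** Why the formula holds.  Sample the motion at the times [k * delta] and
    replace the position by the Riemann sum
    [Y k = x + \sum_(1 <= i <= k) (+/- c * delta)], the sign of the [i]-th term
    being the direction at time [i * delta].  The numbers of Poisson events in
    the successive intervals of length [delta] are independent and have the same
    law, so [Y], together with the direction, is a persistent random walk: at
    each step it reverses its direction with the probability [p] that an
    interval contains an odd number of events ([odd_prob]), and otherwise keeps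
    it.

    For this walk the expected exit time is explicit.  One-step analysis gives a
    linear recursion which is solved exactly, for every [delta], by the quadratic
    [exit_profile]
      [A * (b - y) * (y - a) + B * (b - y)]  (moving right),
      [A * (b - y) * (y - a) + B * (y - a)]  (moving left)
    with [A = walk_curv] and [B = walk_slope] ([exit_profile_step]).  The
    profile vanishes at the end of the interval towards which the walk moves,
    hence is of the order of one step where a walk from inside the interval
    stops, and the expected exit time equals the profile up to this overshoot and
    up to the truncation at finitely many steps ([mean_run_le], [mean_run_ge]).  Since an interval of
    length [delta] contains an odd number of events with probability
    [lambda * delta + o(delta)], one has [delta * A --> lambda / c ^+ 2] and
    [delta * B --> c^-1] when [delta] tends to 0: these are the coefficients of
    the theorem.

    The walk is compared with the motion path by path.  On a grid interval
    without events the Riemann sum is exact, and on any other one its error is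
    at most [2 * c * delta], so that [X (k * delta)] and [Y k] differ by at most
    [2 * c * delta * N (k * delta)] ([grid_walk_approx]).  Up to a fixed horizon
    [M], and off an event of small probability, the exit time of [X] from [[a, b]] is
    therefore at most that of the walk from
    [[a - eps, b + eps]] ([exit_time_le_grid_run]) and at least that of the walk
    from [[a + eps, b - eps]] ([grid_run_le_exit_time]).  Letting [delta] tend to
    0, then [eps] to 0, then [M] to infinity, the two bounds meet
    ([exit_time_integral]).

    For the lower bound the walk has to be allowed to start outside
    [[a + eps, b - eps]], for instance at [b] and moving left.  This is why the
    walk is declared to exit only when it is beyond an end of the interval and
    moves outwards ([stopped]), and why the lower bound also discards the event
    that there is a Poisson event before the time [2 * eps / c] which the motion
    needs to leave the boundary layer. *)

(** * The persistent random walk and its exit times *)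

Lemma mkseq_cons (S : Type) (f : nat -> S) n :
  mkseq f n.+1 = f 0%N :: mkseq (f \o succn) n.
Proof. by rewrite /mkseq /= -[1%N]addn0 iotaDl -map_comp. Qed.

Section flip_mean.
Context {R : realType} (p : R).
Implicit Types (n : nat) (Phi : seq bool -> R).

(** The expectation of [Phi] at a word of [n] independent flips, each of which is
    [true] with probability [p].  Conditioning on the first flip is built in, so
    that one-step analysis of a function defined by recursion on the word is a
    computation. *)
Fixpoint flip_mean n Phi : R :=
  if n is n'.+1 then
    (1 - p) * flip_mean n' (fun z => Phi (false :: z)) +
    p * flip_mean n' (fun z => Phi (true :: z))
  else Phi [::].

Lemma eq_flip_mean n Phi Psi : Phi =1 Psi -> flip_mean n Phi = flip_mean n Psi.
Proof.
elim: n Phi Psi => [|n IHn] Phi Psi eqPhi /=; first exact: eqPhi.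
by congr (_ * _ + _ * _); apply: IHn => z; exact: eqPhi.
Qed.

Lemma flip_mean_cst n r : flip_mean n (cst r) = r.
Proof. by elim: n => //= n ->; rewrite -mulrDl subrK mul1r. Qed.

Lemma flip_meanDl n r Phi : flip_mean n (fun z => r + Phi z) = r + flip_mean n Phi.
Proof. by elim: n Phi => //= n IHn Phi; rewrite !IHn; ring. Qed.

Lemma flip_meanZ n r Phi : flip_mean n (fun z => r * Phi z) = r * flip_mean n Phi.
Proof. by elim: n Phi => //= n IHn Phi; rewrite !IHn; ring. Qed.

End flip_mean.

Section walk.
Context {R : realType} (a b s : R).
Implicit Types (y : R) (e : direction) (z : seq bool).

(** Being beyond an end is not enough: the walk must also move away from the
    interval.  A walk that starts inside exits with the outward direction
    anyway, and one that starts just beyond an end but moves inwards goes on. *)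
Definition stopped y e : bool := if e then b < y else y < a.

(** A flip acts before the step, so that the direction attached to a position is
    that of the step that led to it.  The word of flips is finite, so this is the
    exit time truncated at the length of the word. *)
Fixpoint run_length y e z : nat :=
  if z is f :: z' then
    if stopped y e then 0%N
    else (run_length (y + velocity s (e (+) f)) (e (+) f) z').+1
  else 0%N.

Lemma run_length_le y e z : (run_length y e z <= size z)%N.
Proof.
by elim: z y e => //= f z IHz y e; case: ifP => // _; rewrite ltnS IHz.
Qed.

(* A trajectory determines the flips that produce it: the walk reverses at step
   [k.+1] exactly when [D k] and [D k.+1] differ. *)
Section trajectory.
Variables (Y : nat -> R) (D : nat -> direction).
Hypothesis YS : forall k, Y k.+1 = Y k + velocity s (D k.+1).

Let flips k n := mkseq (fun i => D (k + i)%N (+) D (k + i.+1)%N) n.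

Let flipsS k n : flips k n.+1 = (D k (+) D k.+1) :: flips k.+1 n.
Proof.
rewrite /flips mkseq_cons addn0 addn1; congr (_ :: _).
by apply: eq_map => i /=; rewrite !addSnnS.
Qed.

Lemma run_length_running n k i : (i < run_length (Y k) (D k) (flips k n))%N ->
  ~~ stopped (Y (k + i)%N) (D (k + i)%N).
Proof.
elim: n k i => [|n IHn] k i //; rewrite flipsS /=.
case: ifPn => // nst; rewrite addbA addbb /= -YS.
case: i => [|i]; first by rewrite addn0.
by rewrite ltnS -addSnnS => /IHn.
Qed.

Lemma run_length_stopped n k (m := run_length (Y k) (D k) (flips k n)) :
  (m < n)%N -> stopped (Y (k + m)%N) (D (k + m)%N).
Proof.
rewrite {}/m; elim: n k => [|n IHn] k //; rewrite flipsS /=.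
case: ifPn => [st _|_]; first by rewrite addn0.
by rewrite addbA addbb /= -YS ltnS -addSnnS => /IHn.
Qed.

End trajectory.

Section expected_run_length.
Variable p : R.

Definition mean_run n y e : R :=
  flip_mean p n (fun z => (run_length y e z)%:R).

Lemma mean_run0 y e : mean_run 0 y e = 0.
Proof. by []. Qed.

Lemma mean_runS n y e : mean_run n.+1 y e =
  if stopped y e then 0 else
  1 + (1 - p) * mean_run n (y + velocity s e) e +
      p * mean_run n (y + velocity s (~~ e)) (~~ e).
Proof.
rewrite /mean_run /= addbF addbT; case: ifP => [_|_].
  by rewrite !(flip_mean_cst p n 0) !mulr0 addr0.
have shift y' e' : flip_mean p n (fun z => (run_length y' e' z).+1%:R) =
    1 + mean_run n y' e'.
  by rewrite -flip_meanDl; apply: eq_flip_mean => z; rewrite -natr1 addrC.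
by rewrite !shift /mean_run; ring.
Qed.

End expected_run_length.
End walk.

Local Ltac nonneg := solve [repeat first [lra | apply: mulr_ge0 | apply: addr_ge0]].

Section quadratic_profile.
Context {R : realType}.
Implicit Types (A B a b y k : R) (e : direction).

(** The shape of the expected exit time, for the walk as well as for the
    telegraph process. *)
Definition exit_profile A B a b y e : R :=
  A * (b - y) * (y - a) + B * (if e then b - y else y - a).

Lemma exit_profileZ k A B a b y e :
  k * exit_profile A B a b y e = exit_profile (k * A) (k * B) a b y e.
Proof. by rewrite /exit_profile; ring. Qed.

Variables (a b s p : R).

(** These coefficients are forced by the recursion
    [u y e = 1 + (1 - p) * u (y +/- s) e + p * u (y -/+ s) (~~ e)] for a profile
    [u]: the terms linear in [y] give [B * p = A * s * (1 - 2 * p)], and the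
    constant terms give [A * s ^+ 2 + B * s = 1]. *)
Definition walk_curv : R := p / (s ^+ 2 * (1 - p)).
Definition walk_slope : R := (1 - 2 * p) / (s * (1 - p)).
Local Notation u := (exit_profile walk_curv walk_slope a b).

Lemma walk_curv_ge0 : 0 <= p -> p <= 1 -> 0 <= walk_curv.
Proof. by move=> p0 p1; rewrite divr_ge0// mulr_ge0 ?exprn_even_ge0// subr_ge0. Qed.

Lemma walk_slope_ge0 : 0 < s -> 2 * p <= 1 -> 0 <= walk_slope.
Proof. by move=> s0 p2; rewrite divr_ge0 ?mulr_ge0 ?(ltW s0)//; lra. Qed.

Lemma exit_profile_step y e : 0 < s -> p < 1 ->
  (1 - p) * u (y + velocity s e) e + p * u (y + velocity s (~~ e)) (~~ e) =
  u y e - 1.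
Proof.
move=> s_gt0 p_lt1; have s0 : s != 0 by rewrite gt_eqF.
have p0 : 1 - p != 0 by rewrite gt_eqF// subr_gt0.
rewrite /exit_profile /walk_curv /walk_slope /velocity; case: e => /=; field;
  by rewrite s0 p0.
Qed.

Hypotheses (ab : a < b) (s_gt0 : 0 < s) (p_ge0 : 0 <= p) (p_le : 2 * p <= 1).

Let walk_p_lt1 : p < 1. Proof. by move: p_le => ?; lra. Qed.

(** The profile of, say, the right-moving walk is
    [(b - y) * (A * (y - a) + B)], which changes sign at [b]. *)
Lemma exit_profile_stopped y e : stopped a b y e -> u y e <= 0.
Proof.
rewrite /stopped /exit_profile; move: (ab).
move: (walk_curv_ge0 p_ge0 (ltW walk_p_lt1)) (walk_slope_ge0 s_gt0 p_le).
move: walk_curv walk_slope => A B ab' A0 B0; case: e => /= yb; rewrite -oppr_ge0.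
- rewrite [leRHS](_ : _ = (y - b) * (A * (y - a) + B)); last by ring.
  nonneg.
- rewrite [leRHS](_ : _ = (a - y) * (A * (b - y) + B)); last by ring.
  nonneg.
Qed.

(** The profile decreases by exactly 1 per step on average.  Once it is raised by
    the constant, which is its size one step beyond the end, it is nonnegative
    wherever the walk can be, also where it stops; so it dominates the truncated
    exit time by induction on the number of steps. *)
Lemma mean_run_le n y e : (if e then a <= y <= b + s else a - s <= y <= b) ->
  mean_run a b s p n y e <=
  u y e + s * (walk_curv * (b - a + s) + walk_slope).
Proof.
move: (ab) (s_gt0) (p_ge0) walk_p_lt1 => ab' s' p0 p1.
move: walk_curv walk_slope (walk_curv_ge0 p_ge0 (ltW walk_p_lt1))
  (walk_slope_ge0 s_gt0 p_le)
  (fun y e => @exit_profile_step y e s_gt0 walk_p_lt1) => A B A0 B0 step.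
set v := exit_profile A B a b; set C := s * _.
have C0 : 0 <= C by nonneg.
have inside z f : a <= z <= b -> 0 <= v z f.
  by move=> /andP[az zb]; rewrite /v /exit_profile; case: f; nonneg.
have low z f : (if f then a <= z <= b + s else a - s <= z <= b) ->
    0 <= v z f + C.
  have [st|nst] := boolP (stopped a b z f); last first.
    move=> I; rewrite addr_ge0// inside//.
    by case: f I nst; rewrite /stopped -leNgt => /andP[? ?] ?; apply/andP.
  move: st; rewrite /stopped /v /C /exit_profile.
  case: f => /= st /andP[l h].
  - rewrite [leRHS](_ : _ = (b + s - z) * (A * (z - a) + B) +
      s * A * (b + s - z)); last by ring.
    nonneg.
  - rewrite [leRHS](_ : _ = (z - (a - s)) * (A * (b - z) + B) +
      s * A * (z - (a - s))); last by ring.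
    nonneg.
elim: n y e => [|n IHn] y e I; first by rewrite mean_run0 low.
rewrite mean_runS; case: ifPn => [_|nst]; first exact: low.
have yab : a <= y <= b.
  by case: e I nst; rewrite /stopped -leNgt => /andP[? ?] ?; apply/andP.
have {}IHn f : mean_run a b s p n (y + velocity s f) f <=
    v (y + velocity s f) f + C.
  by apply: IHn; case: f; rewrite /velocity; lra.
have := step y e; rewrite -/v.
have := ler_wpM2l p0 (IHn (~~ e)).
have q0 : 0 <= 1 - p by lra.
have := ler_wpM2l q0 (IHn e); lra.
Qed.

(** Where the walk stops the profile is nonpositive, so the only loss comes from
    the truncation at [n] steps, and it is absorbed by the factor
    [n / (n + C)], [C] being a bound of the profile before the exit.  In the
    induction the factor increases by [C / ((n + C) * (n + 1 + C))] while a step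
    contributes [1 - n / (n + C) = C / (n + C)], which is enough because the
    profile is at most [C].  The region [[l, h]] contains the positions
    beyond an end from which a walk moving inwards may start. *)
Lemma mean_run_ge (l h : R) n y e
    (C := walk_curv * (h - l) ^+ 2 + walk_slope * (h - l)) :
  l <= a -> b <= h -> (if e then l <= y else y <= h) ->
  n%:R / (n%:R + C) * u y e <= mean_run a b s p n y e.
Proof.
rewrite {}/C => la bh; move: (ab) (s_gt0) (p_ge0) walk_p_lt1 => ab' s' p0 p1.
move: walk_curv walk_slope (walk_curv_ge0 p_ge0 (ltW walk_p_lt1))
  (walk_slope_ge0 s_gt0 p_le)
  (fun y e => @exit_profile_step y e s_gt0 walk_p_lt1)
  (@exit_profile_stopped) => A B A0 B0 step out.
move: step out; set v := exit_profile A B a b; set C := _ + B * _.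
move=> step out I.
have C0 : 0 <= C by rewrite /C expr2; nonneg.
have top z f : (if f then l <= z else z <= h) -> ~~ stopped a b z f ->
    v z f <= C.
  rewrite /stopped /v /exit_profile /C -mulrA => I1 I2.
  have zlh : (z <= h) && (l <= z) by case: f I1 I2; rewrite -leNgt; lra.
  apply: lerD; last by rewrite ler_wpM2l//; case: (f); lra.
  by rewrite ler_wpM2l//; nra.
have r_ge0 m : 0 <= m%:R / (m%:R + C) by rewrite divr_ge0// addr_ge0.
elim: n y e I => [|n IHn] y e I; first by rewrite mean_run0 !mul0r.
rewrite mean_runS; case: ifPn => [st|nst].
  by rewrite mulr_ge0_le0// out.
have {}IHn f : n%:R / (n%:R + C) * v (y + velocity s f) f <=
    mean_run a b s p n (y + velocity s f) f.
  apply: IHn; move: I nst; rewrite /stopped /velocity.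
  by case: e; case: f; rewrite -leNgt; lra.
have vC := top _ _ I nst.
have IH1 := ler_wpM2l p0 (IHn (~~ e)).
have q0 : 0 <= 1 - p by lra.
have IH2 := ler_wpM2l q0 (IHn e).
have {IH1 IH2} : n%:R / (n%:R + C) * (v y e - 1) <=
    (1 - p) * mean_run a b s p n (y + velocity s e) e +
    p * mean_run a b s p n (y + velocity s (~~ e)) (~~ e).
  by rewrite -step; lra.
suff : n.+1%:R / (n.+1%:R + C) * v y e <= 1 + n%:R / (n%:R + C) * (v y e - 1).
  lra.
have n0 := ler0n R n.
have [nC0|nC0] := eqVneq (n%:R + C) 0.
  have -> : C = 0 by lra.
  have n00 : n%:R = 0 :> R by lra.
  by rewrite -natr1 n00 add0r addr0 divr1; lra.
have nC : 0 < n%:R + C by rewrite lt_def nC0 addr_ge0.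
rewrite -natr1 -subr_ge0.
have -> : 1 + n%:R / (n%:R + C) * (v y e - 1) -
    (n%:R + 1) / (n%:R + 1 + C) * v y e =
    C / (n%:R + C) / (n%:R + 1 + C) * (n%:R + 1 + C - v y e).
  by field; rewrite !gt_eqF//; lra.
by rewrite mulr_ge0 ?divr_ge0//; lra.
Qed.

End quadratic_profile.

(** * Independent flips and Poisson increments *)

Section integral_of_flips.
Context d (T : measurableType d) (R : realType) (P : probability T R) (p : R).
Implicit Types (A : set T) (xi : nat -> T -> bool) (Phi : seq bool -> R).

Definition flip_weight (z : seq bool) : R := \prod_(f <- z) (if f then p else 1 - p).

Lemma measurable_fun_flips n xi Phi :
  (forall i, measurable_fun [set: T] (xi i)) ->
  measurable_fun [set: T] (fun w => Phi (mkseq (xi ^~ w) n)).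
Proof.
elim: n xi Phi => [|n IHn] xi Phi mxi.
  exact: (measurable_cst (Phi [::])).
rewrite (_ : (fun w => _) = fun w => if xi 0%N w
    then Phi (true :: mkseq ((xi \o succn) ^~ w) n)
    else Phi (false :: mkseq ((xi \o succn) ^~ w) n)); last first.
  by apply/funext => w; rewrite mkseq_cons; case: (xi 0%N w).
apply: measurable_fun_ifT => //.
  by apply: (IHn _ (fun z => Phi (true :: z))) => i; exact: mxi.
by apply: (IHn _ (fun z => Phi (false :: z))) => i; exact: mxi.
Qed.

(** By induction on [n], splitting [A] according to the first flip.  The constant
    [C], which turns out to be [P A], is left free because the hypothesis then
    passes to the two halves of [A] with the constants [C * (1 - p)] and
    [C * p]. *)
Lemma integral_flips n A xi (C : R) Phi : measurable A ->
  (forall i, measurable_fun [set: T] (xi i)) ->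
  (forall z, size z = n ->
    P (A `&` [set w | mkseq (xi ^~ w) n = z]) = (C * flip_weight z)%:E) ->
  (forall z, 0 <= Phi z) ->
  (\int[P]_(w in A) (Phi (mkseq (xi ^~ w) n))%:E = (C * flip_mean p n Phi)%:E)%E.
Proof.
elim: n A xi C Phi => [|n IHn] A xi C Phi mA mxi law Phi0.
  rewrite -[LHS]/(\int[P]_(w in A) (cst (Phi [::])%:E w))%E integral_cst//=.
  move: (law [::] erefl).
  rewrite (_ : _ `&` _ = A) => [->|]; last by apply/seteqP; split => [w []|].
  by rewrite /flip_weight big_nil mulr1 mulrC.
have mX f : measurable (A `&` xi 0%N @^-1` [set f]).
  by apply: measurableI => //; rewrite -[X in measurable X]setTI; exact: mxi.
have AE : A = (A `&` xi 0%N @^-1` [set false]) `|` (A `&` xi 0%N @^-1` [set true]).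
  rewrite -setIUr (_ : _ `|` _ = setT) ?setIT//.
  by apply/seteqP; split => // w _ /=; case: (xi 0%N w); [right|left].
have piece f : (\int[P]_(w in A `&` xi 0%N @^-1` [set f])
    (Phi (mkseq (xi ^~ w) n.+1))%:E =
    (C * (if f then p else 1 - p) * flip_mean p n (fun z => Phi (f :: z)))%:E)%E.
  rewrite -(IHn (A `&` xi 0%N @^-1` [set f]) (xi \o succn) _ (fun z => Phi (f :: z)))//.
  - by apply: eq_integral => w /[!inE] -[_ /= <-]; rewrite mkseq_cons.
  - by move=> i; exact: mxi.
  - move=> z sz; rewrite -setIA (_ : _ `&` [set _ | _] =
        [set w | mkseq (xi ^~ w) n.+1 = f :: z]).
      by rewrite law /= ?sz// /flip_weight big_cons mulrA.
    apply/seteqP; split => w /=; rewrite mkseq_cons => -[-> //].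
    by move=> <-.
rewrite {1}AE ge0_integral_setU//.
- by rewrite !piece -EFinD /=; congr _%:E; ring.
- apply: measurable_funTS; apply/measurable_EFinP.
  exact: (@measurable_fun_flips n.+1 xi Phi).
- by move=> w _; rewrite lee_fin.
- apply/disj_setPRL => w /= [_ wt] [_]; rewrite wt//.
Qed.

End integral_of_flips.

Section poisson_increments.
Context (d : measure_display) (T : measurableType d) (R : realType).
Context (P : probability T R) (lambda : R) (N : R -> T -> nat).
Hypothesis (lambda_gt0 : 0 < lambda) (ppN : poisson_process P lambda N).
Implicit Types s t : R.

Let inc s t w := (N t w - N s w)%N.

Lemma measurable_increment s t : 0 <= s -> 0 <= t ->
  measurable_fun [set: T] (inc s t).
Proof.
move=> s0 t0 _ B _; rewrite setTI.
rewrite (_ : _ @^-1` _ = \bigcup_k \bigcup_(l in [set l | B (k - l)%N])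
    (N t @^-1` [set k] `&` N s @^-1` [set l])); last first.
  apply/seteqP; split => [w Bw|w [k _ [l + [/= kE lE]]]]; last by rewrite -kE -lE.
  by exists (N t w) => //; exists (N s w).
apply: bigcup_measurable => k _; apply: bigcup_measurable => l _.
by apply: measurableI; rewrite -[X in measurable X]setTI;
  [exact: (pp_measurable ppN t0)|exact: (pp_measurable ppN s0)].
Qed.

Lemma increment_prob s t (B : set nat) : 0 <= s -> s < t ->
  P [set w | B (inc s t w)] =
  (\sum_(k <oo | k \in B) (poisson_pmf (lambda * (t - s)) k)%:E)%E.
Proof.
move=> s0 st; rewrite (_ : [set w | _] = \bigcup_(k in B) (inc s t @^-1` [set k])).
  rewrite measure_bigcup.
  - apply: eq_eseriesr => k _; exact: (pp_increment_law ppN).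
  - move=> k _; rewrite -[X in measurable X]setTI.
    by apply: measurable_increment => //; exact: ltW (le_lt_trans s0 st).
  - by move=> i j _ _ [w [/= <- <-]].
by apply/seteqP; split => [w Bw|w [k Bk /= ->]] //; exists (inc s t w).
Qed.

(** The probability of an odd number of events in an interval of mean number of
    events [r]; the interval [[0, r / lambda]] is one of them. *)
Definition odd_prob (r : R) : R := fine (P [set w | odd (inc 0 (r / lambda) w)]).

Lemma odd_increment_prob s t : 0 <= s -> s < t ->
  P [set w | odd (inc s t w)] = (odd_prob (lambda * (t - s)))%:E.
Proof.
move=> s0 st; rewrite /odd_prob fineK; last first.
  rewrite fin_num_measure//.
  rewrite -[X in measurable X]setTI.
  apply: (@measurable_increment _ _ _ _ _ [set k | odd k]) => //.
  by rewrite divr_ge0 ?mulr_ge0 ?ltW// subr_gt0.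
rewrite (mulrC lambda) mulfK ?gt_eqF//.
rewrite (@increment_prob s t [set k | odd k])//.
rewrite (@increment_prob 0 (t - s) [set k | odd k])// ?subr_gt0//.
by rewrite subr0.
Qed.

Lemma even_increment_prob s t : 0 <= s -> s < t ->
  P [set w | ~~ odd (inc s t w)] = (1 - odd_prob (lambda * (t - s)))%:E.
Proof.
move=> s0 st; rewrite EFinB -odd_increment_prob// -probability_setC.
  by congr (P _); apply/seteqP; split => w /= /negP.
rewrite -[X in measurable X]setTI.
by apply: (@measurable_increment _ _ _ _ _ [set k | odd k]) => //;
  exact: ltW (le_lt_trans s0 st).
Qed.

(** An interval with exactly one event has an odd number of them, and one with an
    odd number is not empty.  This determines [odd_prob r] to first order in [r]
    without summing the odd terms of the Poisson law. *)
Lemma odd_prob_bounds (r : R) : 0 < r ->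
  r * expR (- r) <= odd_prob r <= 1 - expR (- r).
Proof.
move=> r0; have t0 : 0 < r / lambda by rewrite divr_gt0.
have E : lambda * (r / lambda - 0) = r.
  by rewrite subr0 mulrC divfK// gt_eqF.
have m B : measurable [set w | B (inc 0 (r / lambda) w)].
  rewrite -[X in measurable X]setTI.
  by apply: (@measurable_increment _ _ _ _ _ [set k | B k]); rewrite // ltW.
have law k : P [set w | inc 0 (r / lambda) w = k] = (poisson_pmf r k)%:E.
  by rewrite (pp_increment_law ppN)// E.
have oddE : P [set w | odd (inc 0 (r / lambda) w)] = (odd_prob r)%:E.
  by rewrite odd_increment_prob// E.
apply/andP; split; rewrite -lee_fin -oddE.
- move: (law 1%N); rewrite /poisson_pmf r0 expr1 divr1 => <-.
  apply: le_measure; rewrite ?inE; [exact: (m [set 1%N])|exact: (m [set k | odd k])|].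
  by move=> w /= ->.
- move: (law 0%N); rewrite /poisson_pmf r0 expr0 divr1 mul1r EFinB => <-.
  rewrite -probability_setC; last exact: (m [set 0%N]).
  apply: le_measure; rewrite ?inE; [exact: (m [set k | odd k])| |].
    exact/measurableC/(m [set 0%N]).
  by move=> w /= o e0; move: o; rewrite e0.
Qed.

Lemma some_event_prob t : 0 < t ->
  P [set w | (0 < N t w)%N] = (1 - expR (- (lambda * t)))%:E.
Proof.
move=> t0; have lt0 : 0 < lambda * t by rewrite mulr_gt0.
move: (pp_increment_law ppN (lexx 0) t0 0).
rewrite subr0 /poisson_pmf lt0 expr0 divr1 mul1r EFinB => <-.
rewrite -probability_setC; last first.
  rewrite -[X in measurable X]setTI.
  by apply: (@measurable_increment _ _ _ _ _ [set 0%N]); rewrite // ltW.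
congr (P _); apply/seteqP; split => w /=; rewrite (pp_start ppN) subn0.
  by move=> + e; rewrite e.
by move/eqP; rewrite lt0n.
Qed.

(** The events decrease to the empty set as [N t] is finite. *)
Lemma many_events_prob t (k : R) : 0 <= t -> 0 < k ->
  fine (P [set w | k * n.+1%:R < (N t w)%:R]) @[n --> \oo] --> 0.
Proof.
move=> t0 k0; pose F n := [set w | k * n.+1%:R < (N t w)%:R].
have mF n : measurable (F n).
  rewrite -[X in measurable X]setTI.
  exact: (pp_measurable ppN t0 measurableT
    (Y := [set j : nat | k * n.+1%:R < j%:R])).
have F0 : \bigcap_n F n = set0.
  apply/seteqP; split => // w Fw.
  have := Fw (Num.truncn ((N t w)%:R / k)) I; rewrite /F /= -ltr_pdivlMl// mulrC.
  by move/(lt_trans (truncnS_gt _)); rewrite ltxx.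
rewrite -[X in _ --> X]/(fine 0%E) -(measure0 P) -F0.
apply: fine_cvg; rewrite fineK; last by rewrite F0 measure0.
apply: (nonincreasing_cvg_mu (F := F)) => //.
- by rewrite (le_lt_trans (probability_le1 _ _))// ltry.
- by rewrite F0.
- move=> i j ij; apply/subsetPset => w; rewrite /F /=; apply: le_lt_trans.
  by rewrite ler_pM2l// ler_nat.
Qed.

End poisson_increments.

(** * Sample paths of the telegraph process *)

(** By continuity of the paths, an exit before [r] is witnessed at a rational
    time before [r], which makes the infimum over all times countable. *)
Lemma measurable_exit_time d (T : measurableType d) (R : realType) (a b c : R)
    (X : R -> T -> R) : 0 < c ->
  (forall t : R, 0 <= t -> measurable_fun [set: T] (X t)) ->
  (forall w (s t : R), 0 <= s -> s <= t -> `|X t w - X s w| <= c * (t - s)) ->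
  measurable_fun [set: T] (exit_time a b X).
Proof.
move=> c0 mX lip; apply: (measurability _ (ErealGenCInfty.measurableE R)) => //.
move=> _ [_ [r ->] <-]; rewrite setTI.
pose F (q : rat) := if (0 < ratr q :> R) && (ratr q < r)
  then X (ratr q) @^-1` (~` `[a, b]%classic) else set0.
rewrite (_ : _ @^-1` _ = ~` \bigcup_q F q).
  apply: measurableC; apply: bigcupT_measurable_rat => q; rewrite /F.
  case: ifP => // /andP[q0 _]; rewrite -[X in measurable X]setTI.
  by apply: mX; rewrite ?(ltW q0)//; exact: measurableC.
apply/seteqP; split => w /=; rewrite in_itv/= andbT.
  move=> rtau [q _]; rewrite /F; case: ifP => // /andP[q0 qr] /= qX.
  have : (exit_time a b X w <= (ratr q)%:E)%E.
    by apply: ereal_inf_lbound; exists (ratr q).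
  by move/(le_trans rtau); rewrite lee_fin leNgt qr.
move=> out; rewrite leNgt; apply/negP => /ereal_inf_ltP[_ [t [t0 tX] <-]].
rewrite lte_fin => tr; apply: out.
pose gap := if X t w < a then a - X t w else X t w - b.
have gap0 : 0 < gap.
  rewrite /gap; case: (ltP (X t w) a) => aX; rewrite subr_gt0//.
  by rewrite ltNge; apply/negP => Xb; apply: tX; rewrite aX Xb.
have tm : t < Num.min r (t + gap / c) by rewrite lt_min tr ltrDl divr_gt0.
have [q] := rat_in_itvoo tm; rewrite in_itv => /= /andP[tq qm].
move: qm; rewrite lt_min => /andP[qr qg]; exists q => //.
rewrite /F qr (lt_trans t0 tq)/= in_itv/=; apply/negP.
have := lip w t (ratr q) (ltW t0) (ltW tq).
have : c * (ratr q - t) < gap.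
  by rewrite mulrC -ltr_pdivlMr// ltrBlDl.
rewrite /gap; case: (ltP (X t w) a) => aX h1 h2; rewrite negb_and -!ltNge; apply/orP.
  by left; move: h1 h2; rewrite ler_norml; lra.
by right; move: h1 h2; rewrite ler_norml; lra.
Qed.

Section telegraph_paths.
Context (R : realType) (lambda c x : R).
Context (d : measure_display) (T : measurableType d) (P : probability T R).
Context (N : R -> T -> nat) (D : R -> T -> direction) (X : R -> T -> R).
Hypothesis (c_gt0 : 0 < c) (tele : telegraph_process P lambda c x N D X).

Implicit Types (s t delta : R) (w : T).

Let ppN := tp_poisson tele.
Local Notation mu := (@lebesgue_measure R).

Lemma directionE t w : 0 <= t -> D t w = D 0 w (+) odd (N t w).
Proof.
move=> t0; rewrite (tp_dir tele)//; elim: (N t w) => [|n IHn] /=.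
  by rewrite addbF.
by rewrite IHn addbN.
Qed.

Lemma direction_flip s t w : 0 <= s -> s <= t ->
  D s w (+) D t w = odd (N t w - N s w).
Proof.
move=> s0 st; rewrite (directionE w s0) (directionE w (le_trans s0 st)).
rewrite oddB ?(pp_nondecreasing ppN)//.
by case: (D 0 w) => /=; case: (odd (N t w)); case: (odd (N s w)).
Qed.

Lemma measurable_direction t : 0 <= t -> measurable_fun [set: T] (D t).
Proof.
move=> t0; rewrite (_ : D t = fun w => if odd (N t w) then ~~ D 0 w else D 0 w).
  apply: measurable_fun_ifT.
  - by apply: measurableT_comp => //; exact: (pp_measurable ppN t0).
  - by apply: measurableT_comp => //; exact: (tp_dir0_measurable tele).
  - exact: (tp_dir0_measurable tele).
by apply/funext => w; rewrite (directionE w t0); case: (odd _); rewrite ?addbT ?addbF.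
Qed.

Lemma velocity_norm e : `|velocity c e| = c.
Proof. by rewrite /velocity; case: e; rewrite ?normrN gtr0_norm. Qed.

(** The path of [N] is monotone, so the times at which it takes a given value form
    an interval; thus the velocity is a measurable function of time. *)
Lemma velocity_integrable s t w : 0 <= s ->
  mu.-integrable `[s, t] (EFin \o (fun u => velocity c (D u w))).
Proof.
move=> s0; apply: measurable_bounded_integrable => //.
- by rewrite /= lebesgue_measure_itv /=; case: ifP => _; rewrite ?ltry// -EFinB ltry.
(* [N] is only constrained, hence only monotone, at nonnegative times. *)
- pose Nc u := N (Num.max u 0) w.
  have Nc_mono u v : u <= v -> (Nc u <= Nc v)%N.
    move=> uv; apply: (pp_nondecreasing ppN); first by rewrite le_max lexx orbT.
    exact: le_max2.
  have mNc : measurable_fun [set: R] Nc.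
    move=> _ B _; rewrite setTI (_ : _ @^-1` _ = \bigcup_(k in B) (Nc @^-1` [set k])).
      apply: bigcup_measurable => k _; apply: is_interval_measurable.
      move=> u v /= uk vk z /andP[uz zv]; apply/eqP; rewrite eqn_leq.
      by rewrite -{1}vk -uk !Nc_mono.
    by apply/seteqP; split => [u Bu|u [k Bk /= ->]] //; exists (Nc u).
  apply: (@eq_measurable_fun _ _ _ _ _
    (fun u => if odd (Nc u) then velocity c (~~ D 0 w) else velocity c (D 0 w))).
    move=> u /[!inE] /=; rewrite in_itv => /= /andP[su _].
    have u0 := le_trans s0 su.
    by rewrite (directionE w u0) /Nc max_l//; case: (odd _); rewrite ?addbT ?addbF.
  apply: measurable_funTS; apply: measurable_fun_ifT => //.
  by apply: measurableT_comp.
- exists c; split; first by rewrite num_real.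
  by move=> M cM u _ /=; rewrite velocity_norm ltW.
Qed.

Lemma displacementE s t w : 0 <= s -> s <= t ->
  X t w - X s w = \int[mu]_(u in `]s, t]) velocity c (D u w).
Proof.
move=> s0 st; rewrite !(tp_pos tele) ?(le_trans s0 st)// opprD addrACA subrr add0r.
by apply: Rintegral_itvB; rewrite ?bnd_simp//; exact: velocity_integrable.
Qed.

Lemma itv_oc_length s t : s <= t -> fine (mu `]s, t]%classic) = t - s.
Proof.
rewrite lebesgue_measure_itv /= lte_fin le_eqVlt => /predU1P[->|->] //=.
by rewrite ltxx subrr.
Qed.

Lemma displacement_le s t w : 0 <= s -> s <= t ->
  `|X t w - X s w| <= c * (t - s).
Proof.
move=> s0 st; rewrite displacementE//; apply: le_trans.
  apply: le_normr_Rintegral => //.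
  apply: integrableS (velocity_integrable t w s0) => //.
  by apply: subset_itvr; rewrite bnd_simp.
rewrite (@eq_Rintegral _ _ _ _ _ (cst c)); last by move=> u _; rewrite /= velocity_norm.
by rewrite Rintegral_cst// itv_oc_length.
Qed.

Lemma displacement_steady s t w : 0 <= s -> s <= t -> N t w = N s w ->
  X t w - X s w = velocity c (D t w) * (t - s).
Proof.
move=> s0 st NE; rewrite displacementE//.
rewrite (@eq_Rintegral _ _ _ _ _ (cst (velocity c (D t w)))).
  by rewrite Rintegral_cst// itv_oc_length.
move=> u /[!inE] /=; rewrite in_itv => /= /andP[su ut].
have u0 := le_trans s0 (ltW su).
rewrite (directionE w u0) (directionE w (le_trans u0 ut)).
congr (velocity c (_ (+) odd _)).
by apply/eqP; rewrite eqn_leq (pp_nondecreasing ppN)//= NE (pp_nondecreasing ppN)// ltW.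
Qed.

(** Either no event occurs, and the motion is uniform, or at least one does, and
    both displacements are at most [c * (t - s)].  Bounding the error by the
    number of events makes the errors on successive intervals add up to a
    multiple of [N]. *)
Lemma displacement_approx s t w : 0 <= s -> s <= t ->
  `|X t w - X s w - velocity c (D t w) * (t - s)| <=
  2 * c * (t - s) * (N t w - N s w)%:R.
Proof.
move=> s0 st; have mono := pp_nondecreasing ppN w s0 st.
have ts : 0 <= t - s by rewrite subr_ge0.
have ts0 : 0 <= c * (t - s) by rewrite mulr_ge0 ?(ltW c_gt0).
have [/eqP NE|NE] := boolP (N t w == N s w).
  by rewrite displacement_steady// subrr normr0 NE subnn mulr0.
apply: (@le_trans _ _ (2 * c * (t - s))).
  apply: le_trans (ler_normB _ _) _.
  rewrite normrM velocity_norm (ger0_norm ts).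
  by have := displacement_le w s0 st; lra.
rewrite ler_peMr ?mulr_ge0 ?(ltW c_gt0)// ler1n subn_gt0.
by rewrite ltn_neqAle eq_sym NE.
Qed.

(** The velocity is taken at the right end of each grid interval: the last step
    has then the current direction, as in [run_length]. *)
Definition grid_walk (delta : R) (k : nat) (w : T) : R :=
  x + \sum_(i < k) velocity (c * delta) (D (delta * i.+1%:R) w).

Lemma grid_walkS delta k w : grid_walk delta k.+1 w =
  grid_walk delta k w + velocity (c * delta) (D (delta * k.+1%:R) w).
Proof. by rewrite /grid_walk big_ord_recr addrA. Qed.

Lemma position0 w : X 0 w = x.
Proof. by rewrite (tp_pos tele)// set_itv1 Rintegral_set1 addr0. Qed.

Lemma grid_walk_approx delta k w : 0 <= delta ->
  `|X (delta * k%:R) w - grid_walk delta k w| <=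
  2 * (c * delta) * (N (delta * k%:R) w)%:R.
Proof.
move=> dl0; elim: k => [|k IHk].
  by rewrite mulr0 position0 /grid_walk big_ord0 addr0 subrr normr0 !mulr_ge0// ltW.
rewrite grid_walkS.
have k0 : 0 <= delta * k%:R by rewrite mulr_ge0.
have kS : delta * k%:R <= delta * k.+1%:R by rewrite ler_wpM2l// ler_nat.
have := displacement_approx w k0 kS.
rewrite natrB ?(pp_nondecreasing ppN)//.
have -> : delta * k.+1%:R - delta * k%:R = delta by rewrite -natr1; ring.
have -> : velocity c (D (delta * k.+1%:R) w) * delta =
    velocity (c * delta) (D (delta * k.+1%:R) w).
  by rewrite /velocity; case: ifP; rewrite ?mulNr.
set X1 := X _ w; set X0 := X _ w in IHk *; set Y := grid_walk _ _ _ in IHk *.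
set v := velocity _ _; move=> h.
have -> : X1 - (Y + v) = (X1 - X0 - v) + (X0 - Y) by ring.
apply: le_trans (ler_normD _ _) _; apply: le_trans (lerD h IHk) _.
by rewrite le_eqVlt; apply/orP; left; apply/eqP; ring.
Qed.

Lemma measurable_grid_walk delta k : 0 <= delta ->
  measurable_fun [set: T] (grid_walk delta k).
Proof.
move=> dl0; apply: measurable_funD => //; apply: measurable_sum => i.
apply: measurable_fun_ifT => //; apply: measurable_direction.
exact: mulr_ge0.
Qed.

(** [X t] is the limit of its Riemann sums, each a function of finitely many
    directions. *)
Lemma measurable_position t : 0 <= t -> measurable_fun [set: T] (X t).
Proof.
move=> t0; apply: (@measurable_fun_cvg _ _ _ _
    (fun n => grid_walk (t / n.+1%:R) n.+1)) => [n|w _].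
  by apply: measurable_grid_walk; rewrite divr_ge0.
apply/cvgrPdist_le => e e0.
have k0 : 0 <= 2 * (c * t) * (N t w)%:R by rewrite !mulr_ge0// ltW.
near=> n.
have := @grid_walk_approx (t / n.+1%:R) n.+1 w (divr_ge0 t0 (ler0n _ _)).
rewrite divfK//; move/le_trans; apply.
rewrite (_ : _ * _ = 2 * (c * t) * (N t w)%:R / n.+1%:R); last first.
  by field.
rewrite ler_pdivrMr// -ler_pdivrMl//; apply: ltW.
apply: (lt_le_trans (truncnS_gt _)); rewrite ler_nat ltnS.
by near: n; exists (Num.truncn (e^-1 * (2 * (c * t) * (N t w)%:R))) => // m.
Unshelve. all: by end_near. Qed.

Lemma measurable_telegraph_exit_time a b : measurable_fun [set: T] (exit_time a b X).
Proof.
apply: (@measurable_exit_time _ _ _ _ _ c) => //; first exact: measurable_position.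
by move=> w s t; exact: displacement_le.
Qed.

End telegraph_paths.

(** * Comparison of the exit time with the walk *)

(** A walk that moves up only to places below [B] exceeds [B] only during its
    initial descent, if it starts above [B]. *)
Lemma walk_stays_below (R : realType) (Y : nat -> R) (D : nat -> direction)
    (s B : R) (m : nat) : 0 < s ->
  (forall k, Y k.+1 = Y k + velocity s (D k.+1)) ->
  (forall k, (k < m)%N -> D k -> Y k <= B) ->
  forall k, (k < m)%N -> Y k <= B \/ ~~ D 0%N /\ Y k = Y 0%N - s * k%:R.
Proof.
move=> s0 YS below; elim=> [|k IHk] km.
  have := below _ km; case: (D 0%N) => [/(_ isT)|_]; first by left.
  by right; rewrite mulr0 subr0.
have := below _ km; rewrite YS; case: (D k.+1) => [/(_ isT)|_]; first by left.
have [Yk|[D0 Yk]] := IHk (ltnW km); [left|right].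
  by rewrite /velocity; lra.
by split=> //; rewrite Yk /velocity -natr1; ring.
Qed.

Section telegraph_comparison.
Context (R : realType) (lambda c x : R).
Context (d : measure_display) (T : measurableType d) (P : probability T R).
Context (N : R -> T -> nat) (D : R -> T -> direction) (X : R -> T -> R).
Hypothesis (lambda_gt0 : 0 < lambda) (c_gt0 : 0 < c).
Hypothesis (tele : telegraph_process P lambda c x N D X).
Context (a b : R) (x_ab : a <= x <= b).

Let ppN := tp_poisson tele.
Local Notation tau := (exit_time a b X).

Definition grid_flip (delta : R) (i : nat) (w : T) : bool :=
  D (delta * i%:R) w (+) D (delta * i.+1%:R) w.

(** The exit step of [grid_walk], expressed through the flips because the law of
    these is known. *)
Definition grid_run (delta : R) (a' b' : R) (n : nat) (w : T) : nat :=
  run_length a' b' (c * delta) x (D 0 w) (mkseq ((grid_flip delta) ^~ w) n).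

Section grid.
Variables (delta : R) (delta_gt0 : 0 < delta).

Let Y w k := grid_walk c x D delta k w.
Let DD w k := D (delta * k%:R) w.

Let YS w k : Y w k.+1 = Y w k + velocity (c * delta) (DD w k.+1).
Proof. exact: grid_walkS. Qed.

Let grid_runE a' b' n w : grid_run delta a' b' n w =
  run_length a' b' (c * delta) (Y w 0%N) (DD w 0%N)
    (mkseq (fun i => DD w (0 + i)%N (+) DD w (0 + i.+1)%N) n).
Proof. by rewrite /Y /DD /grid_walk big_ord0 addr0 mulr0. Qed.

Lemma grid_run_running a' b' n w k : (k < grid_run delta a' b' n w)%N ->
  ~~ stopped a' b' (Y w k) (DD w k).
Proof. by rewrite grid_runE => /(run_length_running (YS w)). Qed.

Lemma grid_run_stopped a' b' n w (m := grid_run delta a' b' n w) : (m < n)%N ->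
  stopped a' b' (Y w m) (DD w m).
Proof. by rewrite /m grid_runE => /(run_length_stopped (YS w)). Qed.

Lemma grid_run_le a' b' n w : (grid_run delta a' b' n w <= n)%N.
Proof. by rewrite /grid_run (leq_trans (run_length_le _ _ _ _ _ _))// size_mkseq. Qed.

Lemma grid_approx n w k (eps : R) :
  2 * (c * delta) * (N (delta * n%:R) w)%:R <= eps -> (k <= n)%N ->
  `|X (delta * k%:R) w - Y w k| <= eps.
Proof.
move=> good kn; apply: le_trans (grid_walk_approx c_gt0 tele _ _ (ltW delta_gt0)) _.
apply: le_trans good; rewrite ler_wpM2l ?mulr_ge0 ?(ltW c_gt0) ?(ltW delta_gt0)//.
rewrite ler_nat (pp_nondecreasing ppN) ?mulr_ge0 ?(ltW delta_gt0)//.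
by rewrite ler_wpM2l ?ler_nat// ltW.
Qed.

(** If the walk is beyond [b + eps] or [a - eps] then [X] is outside [[a, b]] at
    the same grid time; if it has not left after [n] steps the horizon is
    reached. *)
Lemma exit_time_le_grid_run n w (eps : R) : 0 < eps ->
  2 * (c * delta) * (N (delta * n%:R) w)%:R <= eps ->
  (mine (tau w) (delta * n%:R)%:E <=
     (delta * (grid_run delta (a - eps) (b + eps) n w)%:R)%:E)%E.
Proof.
move=> eps0 good; set m := grid_run _ _ _ _ _.
have mn : (m <= n)%N := grid_run_le _ _ _ _.
move: mn; rewrite leq_eqVlt => /predU1P[->|mn]; first by rewrite ge_min lexx orbT.
rewrite ge_min; apply/orP; left; apply: ereal_inf_lbound; exists (delta * m%:R) => //=.
have := grid_run_stopped mn; rewrite -/m => st.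
have := grid_approx good (ltnW mn); rewrite ler_norml => /andP[l h].
move: x_ab => /andP[ax xb]; split.
  rewrite mulr_gt0// ltr0n lt0n; apply/eqP => m0; move: st; rewrite m0 /Y /grid_walk.
  by rewrite big_ord0 addr0 /stopped; case: ifP => _; lra.
by move: st; rewrite /stopped; case: ifP => _ ? /andP[? ?]; lra.
Qed.

(** As long as the walk runs, [walk_stays_below] (applied to the walk and to its
    mirror image) keeps it in [[a + eps, b - eps]], where [eps] covers the
    distance to [X], of which one half is the error of the walk and the other
    half the motion between grid times.  The exception is a walk that starts
    within [eps] of an end and has been moving inwards ever since.  Then either
    it has covered [eps], or the time is at most [2 * eps / c]; in the last case
    no event has occurred and [X] itself has moved inwards. *)
Lemma grid_run_le_exit_time n w (eps : R) : 0 < eps ->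
  c * delta <= eps / 2 ->
  2 * (c * delta) * (N (delta * n%:R) w)%:R <= eps / 2 ->
  N (2 * eps / c) w = 0%N ->
  ((delta * (grid_run delta (a + eps) (b - eps) n w)%:R)%:E <= tau w)%E.
Proof.
move=> eps0 fine_grid good calm; set m := grid_run _ _ _ _ _.
apply: le_ereal_inf_tmp => _ [t [t0 tX] <-]; rewrite lee_fin leNgt; apply/negP => tm.
apply: tX; pose j := Num.truncn (t / delta).
have td0 : 0 <= t / delta by rewrite divr_ge0// ltW.
have /andP[jt tj] : delta * j%:R <= t < delta * j.+1%:R.
  have /andP := truncn_itv td0; rewrite -/j ler_pdivlMr// ltr_pdivrMr//.
  by rewrite ![_ * delta]mulrC => -[-> ->].
have jm : (j < m)%N.
  by rewrite -(ltr_nat R) -(ltr_pM2l delta_gt0) (le_lt_trans jt).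
have jn : (j <= n)%N by rewrite ltnW// (leq_trans jm)// grid_run_le.
have near_walk : `|X t w - Y w j| <= eps.
  rewrite (_ : _ - _ = (X t w - X (delta * j%:R) w) +
    (X (delta * j%:R) w - Y w j)); last by ring.
  apply: le_trans (ler_normD _ _) _.
  have := grid_approx good jn.
  have j0 : 0 <= delta * j%:R by rewrite mulr_ge0// ltW.
  have := displacement_le c_gt0 tele w j0 jt.
  have : c * (t - delta * j%:R) <= c * delta.
    by rewrite ler_pM2l//; move: tj; rewrite -natr1; lra.
  lra.
move: near_walk; rewrite ler_norml => /andP[l h].
have Y0 : Y w 0%N = x by rewrite /Y /grid_walk big_ord0 addr0.
have D0 : DD w 0%N = D 0 w by rewrite /DD mulr0.
have start : c * delta * j%:R < eps -> X t w = x + velocity c (D 0 w) * t.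
  move=> js.
  have teta : t <= 2 * eps / c.
    rewrite ler_pdivlMr// mulrC; apply: ltW.
    have : c * t < c * (delta * j.+1%:R) by rewrite ltr_pM2l.
    by rewrite -natr1; lra.
  have Nt : N t w = 0%N.
    apply/eqP; rewrite -leqn0 -calm; apply: (pp_nondecreasing ppN) => //.
    exact: ltW.
  have NE : N t w = N 0 w by rewrite Nt (pp_start ppN).
  have := displacement_steady c_gt0 tele (lexx 0) (ltW t0) NE.
  rewrite (position0 tele) (directionE tele w (ltW t0)) Nt addbF subr0.
  by move=> <-; ring.
move: x_ab => /andP[ax xb]; have ct0 : 0 <= c * t by rewrite mulr_ge0// ltW.
have s0 : 0 < c * delta by rewrite mulr_gt0.
apply/andP; split.
- have YSN k : - Y w k.+1 = - Y w k + velocity (c * delta) (~~ DD w k.+1).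
    by rewrite YS /velocity; case: (DD w k.+1) => /=; ring.
  have [k km Dk|Yj|[Dj Yj]] :=
      @walk_stays_below _ (fun k => - Y w k) (fun k => ~~ DD w k)
        (c * delta) (- (a + eps)) m s0 YSN _ j jm.
  + have := grid_run_running km; rewrite /stopped (negbTE Dk).
    by rewrite -leNgt lerN2.
  + by move: Yj l h; lra.
  + have [js|js] := ltP (c * delta * j%:R) eps.
      move: Dj; rewrite negbK D0 (start js) => ->; rewrite /velocity; lra.
    move: Yj; rewrite Y0; lra.
- have [k km Dk|Yj|[Dj Yj]] :=
      @walk_stays_below _ (Y w) (DD w) (c * delta) (b - eps) m s0 (YS w) _ j jm.
  + by have := grid_run_running km; rewrite /stopped Dk -leNgt.
  + by move: Yj l h; lra.
  + have [js|js] := ltP (c * delta * j%:R) eps.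
      move: Dj; rewrite D0 (start js) => /negbTE ->; rewrite /velocity; lra.
    move: Yj; rewrite Y0; lra.
Qed.

Let p := odd_prob P lambda N (lambda * delta).

Lemma grid_flipE i w : grid_flip delta i w =
  odd (N (delta * i.+1%:R) w - N (delta * i%:R) w).
Proof.
apply: (direction_flip tele); first by rewrite mulr_ge0// ltW.
by rewrite ler_wpM2l ?ler_nat// ltW.
Qed.

Lemma measurable_grid_flip i : measurable_fun [set: T] (grid_flip delta i).
Proof.
rewrite (_ : grid_flip _ _ = odd \o
    (fun w => (N (delta * i.+1%:R) w - N (delta * i%:R) w)%N)).
  apply: measurableT_comp => //; apply: (measurable_increment ppN);
    by rewrite mulr_ge0// ltW.
by apply/funext => w; exact: grid_flipE.
Qed.

Lemma grid_flips_law n z : size z = n ->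
  P [set w | mkseq ((grid_flip delta) ^~ w) n = z] = (flip_weight p z)%:E.
Proof.
move=> sz.
pose B (i : 'I_n) : set nat := [set k | odd k = nth false z i].
have t0 : 0 <= delta * 0%:R by rewrite mulr0.
have tS i : (i < n)%N -> delta * i%:R < delta * i.+1%:R.
  by move=> _; rewrite ltr_pM2l// ltr_nat.
rewrite (_ : [set w | _] = \bigcap_(i in [set: 'I_n])
   ((fun w => (N (delta * i.+1%:R) w - N (delta * i%:R) w)%N) @^-1` B i)).
  rewrite (pp_increment_indep ppN (t := fun i => delta * i%:R) t0 tS)//.
  rewrite /flip_weight (big_nth false) big_mkord sz -prodEFin; apply: eq_bigr => i _.
  have E : lambda * (delta * i.+1%:R - delta * i%:R) = lambda * delta.
    by rewrite -natr1; ring.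
  have i0 : 0 <= delta * i%:R by rewrite mulr_ge0// ltW.
  rewrite (_ : _ @^-1` B i = [set w |
    odd (N (delta * i.+1%:R) w - N (delta * i%:R) w) = nth false z i])//.
  case: (nth false z i).
    by have := odd_increment_prob lambda_gt0 ppN i0 (tS _ (ltn_ord i)); rewrite E.
  have := even_increment_prob lambda_gt0 ppN i0 (tS _ (ltn_ord i)); rewrite E => <-.
  by congr (P _); apply/seteqP; split => w /= => [->|/negbTE].
apply/seteqP; split => w /=.
  by move=> zE i _; rewrite /B /= -zE nth_mkseq// grid_flipE.
move=> zE; apply: (@eq_from_nth _ false); rewrite size_mkseq ?sz// => i ilt.
by have := zE (Ordinal ilt) I; rewrite /B /= nth_mkseq// grid_flipE.
Qed.

(** The flips are measurable with respect to the process [N], of which the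
    initial direction is independent. *)
Lemma start_flips_law e n z : size z = n ->
  P ([set w | D 0 w = e] `&` [set w | mkseq ((grid_flip delta) ^~ w) n = z]) =
  (2^-1 * flip_weight p z)%:E.
Proof.
move=> sz; rewrite EFinM -(tp_dir0_law tele e) -(grid_flips_law sz).
apply: (tp_dir0_indep tele).
  by exists [set e] => //; rewrite setTI.
pose U : measurableType _ := g_sigma_algebraType
  (\bigcup_(t in [set t : R | 0 <= t]) preimage_set_system [set: T] (N t) measurable).
have mN t : 0 <= t -> measurable_fun [set: U] (N t : U -> nat).
  move=> tge _ A mA; apply: sub_sigma_algebra; exists t => //; by exists A.
have mflip i : measurable_fun [set: U] (grid_flip delta i : U -> bool).
  have -> : grid_flip delta i = fun w =>
      odd (N (delta * i.+1%:R) w) (+) odd (N (delta * i%:R) w).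
    apply/funext => w; rewrite grid_flipE oddB//.
    apply: (pp_nondecreasing ppN); first by rewrite mulr_ge0// ltW.
    by rewrite ler_wpM2l ?ler_nat// ltW.
  have modd k : measurable_fun [set: U] (fun w : U => odd (N (delta * k%:R) w)).
    apply: (@measurableT_comp _ _ _ _ _ _ odd) => //; apply: mN.
    by rewrite mulr_ge0// ltW.
  rewrite (_ : (fun w => _) = fun w : U => if odd (N (delta * i.+1%:R) w) then
     ~~ odd (N (delta * i%:R) w) else odd (N (delta * i%:R) w)).
    apply: measurable_fun_ifT => //.
    exact: (@measurableT_comp _ _ _ _ _ _ negb).
  by apply/funext => w; case: (odd _).
have := @measurable_fun_flips _ U R n (grid_flip delta) (fun y => (y == z)%:R) mflip
  measurableT [set 1] (measurable_set1 _).
rewrite setTI; congr (measurable _); apply/seteqP; split => w /=.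
  by case: eqP => // _ /eqP; rewrite eq_sym oner_eq0.
by move=> ->; rewrite eqxx.
Qed.

Lemma measurable_start e : measurable [set w | D 0 w = e].
Proof.
rewrite -[X in measurable X]setTI.
exact: (tp_dir0_measurable tele measurableT (Y := [set e])).
Qed.

Lemma measurable_grid_run a' b' n : measurable_fun [set: T]
  (fun w => delta * (grid_run delta a' b' n w)%:R).
Proof.
have m e := @measurable_fun_flips _ T R n _
  (fun z => delta * (run_length a' b' (c * delta) x e z)%:R) measurable_grid_flip.
rewrite (_ : (fun w => _) = fun w => if D 0 w
  then delta * (run_length a' b' (c * delta) x true (mkseq ((grid_flip delta) ^~ w) n))%:R
  else delta * (run_length a' b' (c * delta) x false (mkseq ((grid_flip delta) ^~ w) n))%:R).
  apply: measurable_fun_ifT; [exact: (tp_dir0_measurable tele)|exact: m|exact: m].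
by apply/funext => w; rewrite /grid_run; case: (D 0 w).
Qed.

Lemma expected_grid_run e a' b' n :
  (\int[P]_(w in [set w | D 0 w = e]) (delta * (grid_run delta a' b' n w)%:R)%:E =
   (2^-1 * (delta * mean_run a' b' (c * delta) p n x e))%:E)%E.
Proof.
rewrite -(_ : flip_mean p n (fun z => delta * (run_length a' b' (c * delta) x e z)%:R) = delta * _).
  rewrite -(integral_flips (P := P) (A := [set w | D 0 w = e]) (xi := grid_flip delta) (n := n)).
  - by apply: eq_integral => w /[!inE] /= <-.
  - exact: measurable_start.
  - exact: measurable_grid_flip.
  - exact: start_flips_law.
  - by move=> z; rewrite mulr_ge0// ltW.
exact: flip_meanZ.
Qed.

End grid.
End telegraph_comparison.

(** * Passage to the limit *)

(** The form in which the pathwise comparisons, which hold off an exceptional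
    event [B], are integrated. *)
Lemma integral_le_off_event d (T : measurableType d) (R : realType)
    (P : probability T R) (A B : set T) (f g : T -> \bar R) (M : R) :
  measurable A -> measurable B -> measurable_fun [set: T] f ->
  measurable_fun [set: T] g -> (forall w, (0 <= f w)%E) ->
  (forall w, (0 <= g w)%E) -> 0 <= M ->
  (forall w, A w -> ~ B w -> (f w <= g w)%E) ->
  (forall w, A w -> B w -> (f w <= M%:E)%E) ->
  (\int[P]_(w in A) f w <= \int[P]_(w in A) g w + M%:E * P B)%E.
Proof.
move=> mA mB mf mg f0 g0 M0 off on.
have mI : measurable_fun A (fun w => (M%:E * (\1_B w)%:E)%E).
  apply: measurable_funTS; apply: measurable_funeM; apply/measurable_EFinP.
  exact: measurable_indic.
have I0 w : (0 <= M%:E * (\1_B w)%:E :> \bar R)%E.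
  by rewrite mule_ge0 // lee_fin.
apply: (@le_trans _ _ (\int[P]_(w in A) (g w + M%:E * (\1_B w)%:E))%E).
  apply: ge0_le_integral => //.
  - exact: measurable_funTS.
  - by apply: emeasurable_funD => //; exact: measurable_funTS.
  - move=> w Aw; have [Bw|Bw] := pselect (B w).
      by rewrite indicE mem_set// mule1 (le_trans (on w Aw Bw))// leeDr.
    by rewrite indicE memNset// mule0 adde0 off.
rewrite ge0_integralD//; last exact: measurable_funTS.
rewrite leeD2l// ge0_integralZl//; last first.
  by apply: measurable_funTS; apply/measurable_EFinP; exact: measurable_indic.
rewrite integral_indic// lee_wpmul2l ?lee_fin//.
by apply: le_measure; rewrite ?inE//; exact: measurableI.
Qed.

Lemma cvg_exit_profile (R : realType) (A B a b : nat -> R) (A0 B0 a0 b0 y : R) e :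
  A @ \oo --> A0 -> B @ \oo --> B0 -> a @ \oo --> a0 -> b @ \oo --> b0 ->
  exit_profile (A n) (B n) (a n) (b n) y e @[n --> \oo] --> exit_profile A0 B0 a0 b0 y e.
Proof.
move=> cA cB ca cb; rewrite /exit_profile.
have cay : y - a n @[n --> \oo] --> y - a0 by apply: cvgB => //; exact: cvg_cst.
have cby : b n - y @[n --> \oo] --> b0 - y by apply: cvgB => //; exact: cvg_cst.
apply: cvgD; first by apply: cvgM => //; exact: cvgM.
by apply: cvgM => //; case: e.
Qed.

Section telegraph_limits.
Context (R : realType) (lambda c x : R).
Context (d : measure_display) (T : measurableType d) (P : probability T R).
Context (N : R -> T -> nat) (D : R -> T -> direction) (X : R -> T -> R).
Hypothesis (lambda_gt0 : 0 < lambda) (c_gt0 : 0 < c).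
Hypothesis (tele : telegraph_process P lambda c x N D X).
Context (a b : R) (lt_ab : a < b) (x_ab : a <= x <= b).

Let ppN := tp_poisson tele.
Local Notation tau := (exit_time a b X).
Local Notation Start e := [set w | D 0 w = e].
Local Notation h := (exit_profile (lambda / c ^+ 2) c^-1).

Lemma exit_time_ge0 w : (0 <= tau w)%E.
Proof. by apply: le_ereal_inf_tmp => _ [t [t0 _] <-]; rewrite lee_fin ltW. Qed.

(* The horizon [M] is divided into [n + 1] steps of length [mesh n]; [curv n] and
   [slope n] are the coefficients of the profile in units of time. *)
Section horizon.
Variables (M : R) (M_gt0 : 0 < M).

Let mesh (n : nat) : R := M * n.+1%:R^-1.
Let p (n : nat) : R := odd_prob P lambda N (lambda * mesh n).
Let curv n := mesh n * walk_curv (c * mesh n) (p n).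
Let slope n := mesh n * walk_slope (c * mesh n) (p n).
Let many (k : R) n := [set w | k * n.+1%:R < (N M w)%:R].

Let mesh_gt0 n : 0 < mesh n.
Proof. by rewrite mulr_gt0// invr_gt0. Qed.

Let meshM n : mesh n * n.+1%:R = M.
Proof. by rewrite /mesh divfK. Qed.

Let cvg_mesh : mesh @ \oo --> 0.
Proof. rewrite -(mulr0 M); apply: cvgMl_tmp; exact: cvg_harmonic. Qed.

Let p_bounds n : lambda * expR (- (lambda * mesh n)) <= p n / mesh n <= lambda.
Proof.
have lm : 0 < lambda * mesh n by rewrite mulr_gt0.
have /andP[lo hi] := odd_prob_bounds lambda_gt0 ppN lm.
rewrite ler_pdivlMr// ler_pdivrMr// mulrAC lo/=; apply: le_trans hi _.
by have := expR_ge1Dx (- (lambda * mesh n)); lra.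
Qed.

Let p_ge0 n : 0 <= p n.
Proof.
have /andP[lo _] := p_bounds n.
have := le_trans (mulr_ge0 (ltW lambda_gt0) (expR_ge0 _)) lo.
by rewrite pmulr_lge0// invr_gt0.
Qed.

Let cvg_rate : p n / mesh n @[n --> \oo] --> lambda.
Proof.
apply: (squeeze_cvgr (f := fun n => lambda * expR (- (lambda * mesh n))) (h := cst lambda)).
- by apply: nearW => n; exact: p_bounds.
- rewrite -[X in _ --> X]mulr1 -(expR0 R); apply: cvgMl_tmp.
  apply: continuous_cvg; first exact: continuous_expR.
  by rewrite -oppr0 -[X in - X](mulr0 lambda); apply: cvgN; exact: cvgMl_tmp.
- exact: cvg_cst.
Qed.

Let cvg_p : p @ \oo --> 0.
Proof.
rewrite -(mulr0 lambda) (_ : p = fun n => p n / mesh n * mesh n).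
  exact: cvgM.
by apply/funext => n; rewrite divfK// gt_eqF.
Qed.

Let p_small : \forall n \near \oo, 2 * p n <= 1.
Proof.
have h0 : (0 : R) < 2^-1 by rewrite invr_gt0.
near=> n; rewrite -ler_pdivlMl// mulr1; near: n.
by apply: (cvgr_le (0 : R)).
Unshelve. all: by end_near. Qed.

Let cvg_1p : 1 - p n @[n --> \oo] --> (1 : R).
Proof. by rewrite -[X in _ --> X]subr0; apply: cvgB => //; exact: cvg_cst. Qed.

Let c0 : c != 0. Proof. by rewrite gt_eqF. Qed.
Let mesh0 n : mesh n != 0. Proof. by rewrite gt_eqF. Qed.

Let cvg_curv : curv @ \oo --> lambda / c ^+ 2.
Proof.
rewrite (_ : curv = fun n => p n / mesh n * (c ^+ 2)^-1 * (1 - p n)^-1); last first.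
  apply/funext => n; rewrite /curv /walk_curv invfM.
  by move: (1 - p n)^-1 => r; field; rewrite mesh0 c0.
rewrite -[X in _ --> X]mulr1 -[X in _ * X]invr1.
apply: cvgM; first exact: cvgMr_tmp.
by apply: cvgV => //; exact: oner_neq0.
Qed.

Let cvg_slope : slope @ \oo --> c^-1.
Proof.
rewrite (_ : slope = fun n => (1 - 2 * p n) * c^-1 * (1 - p n)^-1); last first.
  apply/funext => n; rewrite /slope /walk_slope invfM.
  by move: (1 - p n)^-1 => r; field; rewrite mesh0 c0.
rewrite -[X in _ --> X]mulr1 -[X in _ * X]invr1.
apply: cvgM; last by apply: cvgV => //; exact: oner_neq0.
rewrite -[X in _ --> X]mul1r; apply: cvgMr_tmp.
rewrite -[X in _ --> X]subr0 -[X in _ - X](mulr0 2); apply: cvgB; first exact: cvg_cst.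
exact: cvgMl_tmp.
Qed.

Let cvg_many k : 0 < k -> fine (P (many k n)) @[n --> \oo] --> 0.
Proof. by move=> k0; exact: (many_events_prob ppN (ltW M_gt0)). Qed.

Let measurable_many k n : measurable (many k n).
Proof.
rewrite -[X in measurable X]setTI.
exact: (pp_measurable ppN (ltW M_gt0) measurableT (Y := [set j : nat | k * n.+1%:R < j%:R])).
Qed.

Let few_events k n w : ~ many k n w ->
  2 * (c * mesh n) * (N (mesh n * n.+1%:R) w)%:R <= 2 * c * M * k.
Proof.
rewrite /many /= meshM => /negP; rewrite -leNgt => few.
rewrite -[in leRHS](meshM n).
rewrite (_ : 2 * c * _ * k = 2 * (c * mesh n) * (k * n.+1%:R)); last by ring.
by rewrite ler_wpM2l// ltW// !mulr_gt0.
Qed.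

Let measurable_run a' b' n : measurable_fun [set: T]
  (fun w => (mesh n * (grid_run c x D (mesh n) a' b' n.+1 w)%:R)%:E).
Proof. by apply/measurable_EFinP; exact: (measurable_grid_run tele (mesh_gt0 n)). Qed.

(** The limit, as the mesh tends to 0, of the comparison with the walk in the
    larger interval. *)
Lemma truncated_exit_time_le e (eps : R) : 0 < eps ->
  (\int[P]_(w in Start e) mine (tau w) M%:E <=
     (2^-1 * h (a - eps) (b + eps) x e)%:E)%E.
Proof.
move=> eps0.
(* Off [many k n] the error of the walk is at most [2 * c * M * k = eps]. *)
pose k := eps / (2 * c * M).
have k0 : 0 < k by rewrite divr_gt0// !mulr_gt0.
pose bound n := 2^-1 * (exit_profile (curv n) (slope n) (a - eps) (b + eps) x e +
  c * mesh n * (curv n * (b + eps - (a - eps) + c * mesh n) + slope n)) +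
  M * fine (P (many k n)).
have int_le : \forall n \near \oo,
    (\int[P]_(w in Start e) mine (tau w) M%:E <= (bound n)%:E)%E.
  near=> n.
  have p2 : 2 * p n <= 1 by near: n.
  have : (\int[P]_(w in Start e) mine (tau w) M%:E <=
      \int[P]_(w in Start e)
        (mesh n * (grid_run c x D (mesh n) (a - eps) (b + eps) n.+1 w)%:R)%:E +
      M%:E * P (many k n))%E.
    apply: integral_le_off_event => //.
    - exact: (measurable_start tele).
    - apply: measurable_mine => //; exact: (measurable_telegraph_exit_time c_gt0 tele).
    - by move=> w; rewrite le_min exit_time_ge0 lee_fin ltW.
    - by move=> w; rewrite lee_fin mulr_ge0// ltW.
    - exact: ltW.
    - move=> w _ /few_events few.
      rewrite -[X in mine _ X%:E](meshM n).
      apply: (exit_time_le_grid_run c_gt0 tele x_ab (mesh_gt0 n) eps0).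
      apply: le_trans few _.
      by rewrite /k mulrC divfK// gt_eqF// !mulr_gt0.
    - by move=> w _ _; rewrite ge_min lexx orbT.
  move/le_trans; apply; rewrite (expected_grid_run lambda_gt0 tele (mesh_gt0 n)).
  rewrite -[P (many k n)]fineK; last by rewrite fin_num_measure.
  rewrite -EFinM -EFinD lee_fin /bound lerD2r ler_pM2l ?invr_gt0//.
  have s0 : 0 < c * mesh n by rewrite mulr_gt0.
  have lt_eps : a - eps < b + eps by move: lt_ab => ?; lra.
  apply: le_trans.
    apply: ler_wpM2l; first exact/ltW.
    apply: (mean_run_le lt_eps s0 (p_ge0 n) p2).
    move: x_ab => /andP[ax xb].
    by case: (e); apply/andP; split; lra.
  rewrite mulrDr exit_profileZ lerD2l le_eqVlt; apply/orP; left; apply/eqP.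
  by rewrite /curv /slope; ring.
have fin_int : (\int[P]_(w in Start e) mine (tau w) M%:E \is a fin_num)%E.
  have [n /le_lt_trans le_n] := filter_ex int_le.
  rewrite ge0_fin_numE ?le_n ?ltry//.
  by apply: integral_ge0 => w _; rewrite le_min exit_time_ge0 lee_fin ltW.
rewrite -(fineK fin_int) lee_fin.
have cvg_bound : bound @ \oo --> 2^-1 * (h (a - eps) (b + eps) x e +
    0 * (lambda / c ^+ 2 * (b + eps - (a - eps) + 0) + c^-1)) + M * 0.
  have cm : c * mesh n @[n --> \oo] --> 0 by rewrite -(mulr0 c); exact: cvgMl_tmp.
  apply: cvgD; last by apply: cvgMl_tmp; exact: cvg_many.
  apply: cvgMl_tmp; apply: cvgD.
    by apply: cvg_exit_profile => //; exact: cvg_cst.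
  apply: cvgM => //; apply: cvgD => //; apply: cvgM => //.
  by apply: cvgD => //; exact: cvg_cst.
move: cvg_bound; rewrite mul0r mulr0 !addr0 => /cvgr_to_ge; apply.
by apply: filterS int_le => n; rewrite -(fineK fin_int) lee_fin.
Unshelve. all: by end_near. Qed.

(** The limit, as the mesh tends to 0, of the comparison with the walk in the
    smaller interval.  The factor of the profile is the limit of that of
    [mean_run_ge], and the last term is the probability of an event before
    [2 * eps / c], multiplied by the horizon. *)
Lemma exit_time_integral_ge e (eps I : R) : 0 < eps -> 2 * eps < b - a ->
  (\int[P]_(w in Start e) tau w)%E = I%:E ->
  2^-1 * (M / (M + (lambda / c ^+ 2 * (b - a) ^+ 2 + c^-1 * (b - a))) *
    h (a + eps) (b - eps) x e) <=
  I + M * (1 - expR (- (lambda * (2 * eps / c)))).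
Proof.
move=> eps0 eps_ab intE; pose k := eps / 2 / (2 * c * M).
have k0 : 0 < k by rewrite !divr_gt0// !mulr_gt0.
pose t := 2 * eps / c.
have t0 : 0 < t by rewrite divr_gt0// mulr_gt0.
set q := 1 - _.
pose depth n := curv n * (b - a) ^+ 2 + slope n * (b - a).
pose bound n := 2^-1 * (M / (M + depth n) *
  exit_profile (curv n) (slope n) (a + eps) (b - eps) x e) -
  M * fine (P (many k n)).
have mcalm : measurable [set w | (0 < N t w)%N].
  rewrite -[X in measurable X]setTI.
  exact: (pp_measurable ppN (ltW t0) measurableT (Y := [set j : nat | (0 < j)%N])).
have le_int : \forall n \near \oo, bound n <= I + M * q.
  near=> n.
  have p2 : 2 * p n <= 1 by near: n.
  have s0 : 0 < c * mesh n by rewrite mulr_gt0.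
  have s_small : c * mesh n <= eps / 2.
    near: n; apply: (cvgr_le (0 : R)); last by rewrite divr_gt0.
    by rewrite -(mulr0 c); exact: cvgMl_tmp.
  have : (\int[P]_(w in Start e)
      (mesh n * (grid_run c x D (mesh n) (a + eps) (b - eps) n.+1 w)%:R)%:E <=
      \int[P]_(w in Start e) tau w +
      M%:E * P (many k n `|` [set w | (0 < N t w)%N]))%E.
    apply: integral_le_off_event => //.
    - exact: (measurable_start tele).
    - exact: measurableU.
    - exact: (measurable_telegraph_exit_time c_gt0 tele).
    - by move=> w; rewrite lee_fin mulr_ge0// ltW.
    - exact: exit_time_ge0.
    - exact: ltW.
    - move=> w _ /not_orP[/few_events few /negP]; rewrite -leqNgt leqn0 => /eqP calm.
      apply: (grid_run_le_exit_time c_gt0 tele x_ab (mesh_gt0 n) eps0 s_small _ calm).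
      apply: le_trans few _.
      by rewrite /k mulrC divfK// gt_eqF// !mulr_gt0.
    - move=> w _ _; rewrite lee_fin -[leRHS](meshM n).
      by rewrite ler_wpM2l ?ler_nat ?grid_run_le// ltW.
  rewrite (expected_grid_run lambda_gt0 tele (mesh_gt0 n)) intE => le_run.
  have le_prob : (P (many k n `|` [set w | (0 < N t w)%N]) <=
      (fine (P (many k n)) + q)%:E)%E.
    rewrite EFinD fineK ?fin_num_measure//.
    rewrite -(some_event_prob lambda_gt0 ppN t0).
    exact: measureU2.
  have {le_run} : 2^-1 * (mesh n * mean_run (a + eps) (b - eps) (c * mesh n) (p n) n.+1 x e) <=
      I + M * (fine (P (many k n)) + q).
    rewrite -lee_fin; apply: le_trans le_run _.
    by rewrite EFinD leeD2l// EFinM lee_wpmul2l// lee_fin ltW.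
  have lt_eps : a + eps < b - eps by move: eps_ab => ?; lra.
  have low : M / (M + depth n) *
      exit_profile (curv n) (slope n) (a + eps) (b - eps) x e <=
      mesh n * mean_run (a + eps) (b - eps) (c * mesh n) (p n) n.+1 x e.
    have aeps : a <= a + eps by rewrite lerDl ltW.
    have beps : b - eps <= b by rewrite gerBl ltW.
    have start : if e then a <= x else x <= b by case/andP: x_ab; case: (e).
    apply: le_trans (ler_wpM2l (ltW (mesh_gt0 n))
      (mean_run_ge lt_eps s0 (p_ge0 n) p2 n.+1 aeps beps start)).
    rewrite -exit_profileZ mulrCA -(meshM n).
    have -> : depth n = mesh n * (walk_curv (c * mesh n) (p n) * (b - a) ^+ 2 +
        walk_slope (c * mesh n) (p n) * (b - a)).
      by rewrite /depth /curv /slope; ring.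
    by rewrite -mulrDr -mulf_div divff ?mul1r.
  move=> run_le; rewrite /bound lerBlDr.
  apply: le_trans (ler_wpM2l _ low) _; first by rewrite invr_ge0.
  by apply: le_trans run_le _; rewrite addrAC mulrDr addrA.
have B0 : 0 < M + (lambda / c ^+ 2 * (b - a) ^+ 2 + c^-1 * (b - a)).
  have ba0 : 0 < b - a by rewrite subr_gt0.
  by rewrite !addr_gt0// !mulr_gt0// ?invr_gt0// exprn_gt0.
have cvg_bound : bound @ \oo --> 2^-1 * (M / (M + (lambda / c ^+ 2 * (b - a) ^+ 2 +
    c^-1 * (b - a))) * h (a + eps) (b - eps) x e) - M * 0.
  apply: cvgB; last by apply: cvgMl_tmp; exact: cvg_many.
  apply: cvgMl_tmp; apply: cvgM; last by apply: cvg_exit_profile => //; exact: cvg_cst.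
  apply: cvgMl_tmp; apply: cvgV; first by rewrite gt_eqF.
  apply: cvgD; first exact: cvg_cst.
  by apply: cvgD; exact: cvgMr_tmp.
by move: cvg_bound; rewrite mulr0 subr0 => /cvgr_to_le; apply.
Unshelve. all: by end_near. Qed.

End horizon.

(* Any sequence of margins decreasing to 0 would do; the factor ensures
   [2 * eps < b - a], so that the smaller interval is not degenerate. *)
Let eps (n : nat) : R := (b - a) / 4 * n.+1%:R^-1.

Let eps_gt0 n : 0 < eps n.
Proof. by rewrite !mulr_gt0 ?invr_gt0// subr_gt0. Qed.

Let eps_small n : 2 * eps n < b - a.
Proof.
have ba0 : 0 < b - a by rewrite subr_gt0.
have : eps n <= (b - a) / 4.
  by rewrite ler_piMr ?divr_ge0 ?(ltW ba0)// invf_le1// ler1n.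
lra.
Qed.

Let cvg_eps : eps @ \oo --> 0.
Proof. by rewrite -(mulr0 ((b - a) / 4)); apply: cvgMl_tmp; exact: cvg_harmonic. Qed.

(** First the margin tends to 0; then the horizon tends to infinity, by monotone
    convergence of the truncated exit times. *)
Lemma exit_time_integral_le e :
  (\int[P]_(w in Start e) tau w <= (2^-1 * h a b x e)%:E)%E.
Proof.
have trunc_le M : 0 < M ->
    (\int[P]_(w in Start e) mine (tau w) M%:E <= (2^-1 * h a b x e)%:E)%E.
  move=> M0; have bound_n n := truncated_exit_time_le M0 e (eps_gt0 n).
  have fin_int : (\int[P]_(w in Start e) mine (tau w) M%:E \is a fin_num)%E.
    rewrite ge0_fin_numE ?(le_lt_trans (bound_n 0%N)) ?ltry//.
    by apply: integral_ge0 => w _; rewrite le_min exit_time_ge0 lee_fin ltW.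
  rewrite -(fineK fin_int) lee_fin.
  have : 2^-1 * h (a - eps n) (b + eps n) x e @[n --> \oo] --> 2^-1 * h a b x e.
    apply: cvgMl_tmp; apply: cvg_exit_profile; try exact: cvg_cst.
      by rewrite -[X in _ --> X]subr0; apply: cvgB => //; exact: cvg_cst.
    by rewrite -[X in _ --> X]addr0; apply: cvgD => //; exact: cvg_cst.
  by move/cvgr_to_ge; apply; apply: nearW => n; rewrite -lee_fin fineK.
pose g (n : nat) w := mine (tau w) n.+1%:R%:E.
have mtau := measurable_telegraph_exit_time c_gt0 tele a b.
have cvg_g w : g n w @[n --> \oo] --> tau w.
  rewrite /g; case: (tau w) (exit_time_ge0 w) => [r r0||] //.
    apply: cvg_near_cst; near=> n; rewrite min_l// lee_fin ltW//.
    apply: lt_le_trans (truncnS_gt r) _; rewrite ler_nat ltnS.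
    by near: n; exists (Num.truncn r).
  move=> _; apply/cvgeyPge => A; near=> n.
  rewrite min_r ?leey// lee_fin ltW//.
  apply: lt_le_trans (truncnS_gt A) _; rewrite ler_nat ltnS.
  by near: n; exists (Num.truncn A).
rewrite (eq_integral (fun w => limn (g ^~ w))); last first.
  by move=> w _; apply/esym/cvg_lim.
have mg n : measurable_fun (Start e) (g n).
  by apply: measurable_funTS; exact: measurable_mine.
have g0 n w : (0 <= g n w)%E by rewrite /g le_min exit_time_ge0 lee_fin ler0n.
have g_mono w m n : (m <= n)%N -> (g m w <= g n w)%E.
  by move=> mn; apply: le_min2 => //; rewrite lee_fin ler_nat.
have mStart := measurable_start tele e.
rewrite monotone_convergence//; last by move=> w _ m n; exact: g_mono.
apply: lime_le; last by apply: nearW => n; exact: trunc_le.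
apply: ereal_nondecreasing_is_cvgn => m n mn; apply: ge0_le_integral => //.
by move=> w _; exact: g_mono.
Unshelve. all: by end_near. Qed.

(** The upper bound shows that the integral is finite, which the lower bound
    presupposes.  In the latter the margin must tend to 0 before the horizon tends
    to infinity, because its error term is multiplied by the horizon. *)
Lemma exit_time_integral e :
  (\int[P]_(w in Start e) tau w = (2^-1 * h a b x e)%:E)%E.
Proof.
have le_int := exit_time_integral_le e.
have fin_int : (\int[P]_(w in Start e) tau w \is a fin_num)%E.
  rewrite ge0_fin_numE ?(le_lt_trans le_int) ?ltry//.
  by apply: integral_ge0 => w _; exact: exit_time_ge0.
move: le_int; have := esym (fineK fin_int); set I := fine _ => intE.
rewrite intE lee_fin => le_int; congr _%:E; apply/eqP; rewrite eq_le le_int/=.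
set C := lambda / c ^+ 2 * (b - a) ^+ 2 + c^-1 * (b - a).
have long M : 0 < M -> 2^-1 * (M / (M + C) * h a b x e) <= I.
  move=> M0.
  have bound_n n := exit_time_integral_ge M0 (eps_gt0 n) (eps_small n) intE.
  have lhs : 2^-1 * (M / (M + C) * h (a + eps n) (b - eps n) x e) @[n --> \oo] -->
      2^-1 * (M / (M + C) * h a b x e).
    apply: cvgMl_tmp; apply: cvgMl_tmp; apply: cvg_exit_profile; try exact: cvg_cst.
      by rewrite -[X in _ --> X]addr0; apply: cvgD => //; exact: cvg_cst.
    by rewrite -[X in _ --> X]subr0; apply: cvgB => //; exact: cvg_cst.
  have rhs : I + M * (1 - expR (- (lambda * (2 * eps n / c)))) @[n --> \oo] --> I.
    rewrite [X in _ --> X](_ : I = I + M * (1 - 1)); last by rewrite subrr mulr0 addr0.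
    apply: cvgD; first exact: cvg_cst.
    apply: cvgMl_tmp; apply: cvgB; first exact: cvg_cst.
    rewrite -[X in _ --> X](expR0 R); apply: continuous_cvg; first exact: continuous_expR.
    have -> : (fun n => - (lambda * (2 * eps n / c))) =
        fun n => eps n * - (lambda * 2 / c) by apply/funext => n; ring.
    by rewrite -[X in _ --> X](mul0r (- (lambda * 2 / c))); exact: cvgMr_tmp.
  by apply: (ler_cvg_to lhs rhs); apply: nearW => n; exact: bound_n.
clearbody C.
have : 2^-1 * ((1 + C * n.+1%:R^-1)^-1 * h a b x e) @[n --> \oo] -->
    2^-1 * h a b x e.
  rewrite -[X in 2^-1 * X]mul1r -[X in _ * (X * _)]invr1.
  apply: cvgMl_tmp; apply: cvgMr_tmp; apply: cvgV; first exact: oner_neq0.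
  rewrite -[X in _ --> X]addr0; apply: cvgD; first exact: cvg_cst.
  by rewrite -(mulr0 C); apply: cvgMl_tmp; exact: cvg_harmonic.
move/cvgr_to_le; apply; apply: nearW => n; have n0 : (0 : R) < n.+1%:R by [].
apply: le_trans (long _ n0); rewrite le_eqVlt; apply/orP; left; apply/eqP.
by congr (_ * (_ * _)); rewrite -[RHS]invf_div mulrDl (divff (lt0r_neq0 n0)).
Qed.

End telegraph_limits.

Theorem theorem2 (R : realType) (lambda c a b : R)
    (lambda_gt0 : 0 < lambda) (c_gt0 : 0 < c) (lt_ab : a < b)
    (x : R) (x_ab : a <= x <= b)
    (d : measure_display) (T : measurableType d) (P : probability T R)
    (N : R -> T -> nat) (D : R -> T -> direction) (X : R -> T -> R)
    (tele : telegraph_process P lambda c x N D X) :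
  let tau := exit_time a b X in
  let h0 := cond_expectation P tau [set w | X 0 w = x /\ D 0 w = d0] in
  let h1 := cond_expectation P tau [set w | X 0 w = x /\ D 0 w = d1] in
  let h := cond_expectation P tau [set w | X 0 w = x] in
  [/\ h0 = (lambda / c ^+ 2 * (b - x) * (x - a) + (b - x) / c)%:E,
      h1 = (lambda / c ^+ 2 * (b - x) * (x - a) + (x - a) / c)%:E,
      h = ((2^-1)%:E * (h0 + h1))%E
    & h = (lambda / c ^+ 2 * (b - x) * (x - a) + (b - a) / (2 * c))%:E].
Proof.
move=> tau h0 h1 h.
have X0 w : X 0 w = x := position0 tele w.
have startE e : [set w | X 0 w = x /\ D 0 w = e] = [set w | D 0 w = e].
  by apply/seteqP; split => w /= => [[]|].
have condE e : cond_expectation P tau [set w | X 0 w = x /\ D 0 w = e] =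
    (exit_profile (lambda / c ^+ 2) c^-1 a b x e)%:E.
  rewrite /cond_expectation startE (tp_dir0_law tele) /=.
  rewrite (exit_time_integral lambda_gt0 c_gt0 tele lt_ab x_ab) -EFinM invrK.
  by rewrite mulrA divff ?mul1r// pnatr_eq0.
have h0E : h0 = (lambda / c ^+ 2 * (b - x) * (x - a) + (b - x) / c)%:E.
  by rewrite /h0 condE /exit_profile [c^-1 * _]mulrC.
have h1E : h1 = (lambda / c ^+ 2 * (b - x) * (x - a) + (x - a) / c)%:E.
  by rewrite /h1 condE /exit_profile [c^-1 * _]mulrC.
have hE : h = ((2^-1)%:E * (h0 + h1))%E.
  have certain : [set w | X 0 w = x] = setT.
    by apply/seteqP; split => // w _; exact: X0.
  have cover : [set: T] = [set w | D 0 w = d0] `|` [set w | D 0 w = d1].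
    apply/seteqP; split => // w _ /=; rewrite /d0 /d1.
    by case: (D 0 w); [left|right].
  rewrite /h /cond_expectation certain probability_setT /= invr1 mul1e cover.
  rewrite ge0_integral_setU.
  - rewrite !(exit_time_integral lambda_gt0 c_gt0 tele lt_ab x_ab).
    by rewrite /h0 /h1 !condE -!EFinD -EFinM; congr EFin; ring.
  - exact: (measurable_start tele).
  - exact: (measurable_start tele).
  - by apply: measurable_funTS; exact: (measurable_telegraph_exit_time c_gt0 tele).
  - by move=> w _; exact: exit_time_ge0.
  - by apply/disj_setPRL => w /= ->.
split=> //; rewrite hE h0E h1E -EFinD -EFinM; congr _%:E; field.
by rewrite gt_eqF.
Qed.
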